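(* Let $M$ be a closed Kähler manifold of complex dimension $n\ge 2$, let $2\le k\le n$, and let $\beta_0,\dots,\beta_{k-1}$ be real functions on $M$. Assume that $\lambda=\lambda(z)\in\Gamma_{k-1}\subset\mathbb R^n$ satisfies $$\frac{\sigma_k(\lambda)}{\sigma_{k-1}(\lambda)}-\sum_{l=0}^{k-2}\beta_l(z)\frac{\sigma_l(\lambda)}{\sigma_{k-1}(\lambda)}=\beta_{k-1}(z)$$ and that $\beta_l(z)\ge 0$ for $0\le l\le k-2$. Then $$0<\frac{\sigma_l(\lambda)}{\sigma_{k-1}(\lambda)}\le C,\qquad 0\le l\le k-2,$$ where the constant $C$ depends on $n$, $k$, $\inf\beta_l$ and $\sup|\beta_{k-1}|$. Moreover, $$-\sup|\beta_{k-1}|\le\frac{\sigma_k(\lambda)}{\sigma_{k-1}(\lambda)}\le C,$$ where the constant $C$ depends on $n$, $k$, $\inf\beta_l$ for $0\le l\le k-2$, and $\sum_{i=0}^{k-1}|\beta_i|$.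
   Context: For $\lambda\in\mathbb R^n$, $\sigma_j(\lambda)$ is the $j$-th elementary symmetric function, with $\sigma_0=1$, and $\Gamma_j=\{\lambda\in\mathbb R^n:\sigma_i(\lambda)>0,\ 1\le i\le j\}$. Infima and suprema of the $\beta_i$ are taken over $M$.
   Formalization: The upper bound σ_l/σ_{k-1} ≤ C is asserted only when inf β_l > 0 for the same l (it fails for k=2, β_0=β_1=0, λ=(ε,0,…,0)); each |β_i| is assumed bounded on M so that the suprema are finite. *)

(* Defs.v *)
From HB Require Import structures.
From mathcomp Require Import all_boot all_order all_algebra.
From mathcomp Require Import all_classical all_reals all_analysis.
Set Implicit Arguments.
Unset Strict Implicit.
Unset Printing Implicit Defensive.
Import Order.TTheory GRing.Theory Num.Theory.
Import numFieldNormedType.Exports.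
Local Open Scope classical_set_scope.
Local Open Scope ring_scope.

(** * Elementary symmetric functions and the cones Gamma_j *)

Definition sigma (R : realType) (n j : nat) (x : 'rV[R]_n) : R :=
  \sum_(A : {set 'I_n} | #|A| == j) \prod_(i in A) x 0 i.

Definition Gamma (R : realType) (n j : nat) : set 'rV[R]_n :=
  [set x | forall i, (1 <= i <= j)%N -> 0 < sigma i x].

(** * Kähler manifolds

  C^n is encoded as R^n * R^n: the pair (x, y) stands for x + i y.  This keeps
  the real differential calculus of the library available; complex linearity
  is commutation with [cmulI], the multiplication by i. *)

Definition Cn (R : realType) (n : nat) : normedModType R :=
  ('rV[R]_n * 'rV[R]_n)%type.

Definition cmulI (R : realType) (n : nat) (u : Cn R n) : Cn R n := (- u.2, u.1).

(** On an open set [U], [Ck_on m U f] says that [f] is of class C^m there. *)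
Fixpoint Ck_on (R : realType) (V : normedModType R) (m : nat) (U : set V)
    (f : V -> R) : Prop :=
  if m is m'.+1 then
    (forall x, U x -> differentiable f x) /\ (forall v, Ck_on m' U ('D_v f))
  else forall x, U x -> {for x, continuous f}.

Definition smooth_on (R : realType) (V : normedModType R) (U : set V)
    (f : V -> R) : Prop :=
  forall m, Ck_on m U f.

(** A holomorphic map is a differentiable one with complex linear
    differential; on open sets this implies smoothness. *)
Definition holomorphic_at (R : realType) (n : nat) (f : Cn R n -> Cn R n)
    (x : Cn R n) : Prop :=
  differentiable f x /\ forall u, 'd f x (cmulI u) = cmulI ('d f x u).

(** Charts and their inverses are total functions; the values of [chart i]
    outside of [chart_dom i], and those of [chart_inv i] outside of the image
    of [chart_dom i], are irrelevant. *)
Record complex_atlas (R : realType) (n : nat) (M : topologicalType) :=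
  ComplexAtlas {
  chart_index : Type;
  chart_dom : chart_index -> set M;
  chart : chart_index -> M -> Cn R n;
  chart_inv : chart_index -> Cn R n -> M;
  atlas_cover : forall z, exists i, chart_dom i z;
  chart_dom_open : forall i, open (chart_dom i);
  chart_cod_open : forall i, open (chart i @` chart_dom i);
  chartK : forall i z, chart_dom i z -> chart_inv i (chart i z) = z;
  chart_continuous : forall i z, chart_dom i z ->
    {for z, continuous (chart i)};
  chart_inv_continuous : forall i x, (chart i @` chart_dom i) x ->
    {for x, continuous (chart_inv i)};
  transition_holomorphic : forall i j x,
    (chart i @` (chart_dom i `&` chart_dom j)) x ->
    holomorphic_at (chart j \o chart_inv i) x }.

Section ChartNotions.
Context (R : realType) (n : nat) (M : topologicalType).
Context (A : complex_atlas R n M).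
Implicit Types i j : chart_index A.

Definition chart_cod i : set (Cn R n) := chart i @` chart_dom i.

Definition transition_dom i j : set (Cn R n) :=
  chart i @` (chart_dom i `&` chart_dom j).

Definition transition i j : Cn R n -> Cn R n := chart j \o chart_inv i.

End ChartNotions.

(** A Kähler form is a closed positive real (1,1)-form.  It is given by its
    expressions [kform i x] in the charts: at each point [x] of the range of
    chart [i], an alternating bilinear form on C^n regarded as R^(2n).
    Invariance under multiplication by i is being of type (1,1), and
    [kform i x u (cmulI u)] is the squared length of [u] in the Kähler metric.
    [kform_closed] evaluates the exterior derivative on constant vector
    fields. *)
Record kahler_form (R : realType) (n : nat) (M : topologicalType)
    (A : complex_atlas R n M) := KahlerForm {
  kform : chart_index A -> Cn R n -> Cn R n -> Cn R n -> R;
  kform_linear : forall i x, chart_cod i x -> forall (a : R) (u v w : Cn R n),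
    kform i x (a *: u + v) w = a * kform i x u w + kform i x v w;
  kform_alternating : forall i x, chart_cod i x -> forall u v,
    kform i x v u = - kform i x u v;
  kform_type11 : forall i x, chart_cod i x -> forall u v,
    kform i x (cmulI u) (cmulI v) = kform i x u v;
  kform_positive : forall i x, chart_cod i x -> forall u, u != 0 ->
    0 < kform i x u (cmulI u);
  kform_smooth : forall i u v,
    smooth_on (chart_cod i) (fun x => kform i x u v);
  kform_closed : forall i x, chart_cod i x -> forall u v w,
    'D_u (fun y => kform i y v w) x + 'D_v (fun y => kform i y w u) x
      + 'D_w (fun y => kform i y u v) x = 0;
  kform_compatible : forall i j x, transition_dom i j x -> forall u v,
    kform i x u v =
    kform j (transition i j x) ('d (transition i j) x u)
      ('d (transition i j) x v) }.

(** A closed manifold is a compact one without boundary (here there is no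
    boundary, charts being modelled on open subsets of C^n).  Second
    countability follows from compactness. *)
Record closed_kahler_manifold (R : realType) (n : nat) := ClosedKahler {
  carrier :> topologicalType;
  carrier_hausdorff : hausdorff_space carrier;
  carrier_compact : compact [set: carrier];
  carrier_atlas : complex_atlas R n carrier;
  carrier_form : kahler_form carrier_atlas }.

(* Main.v *)
(** Only a bound for [sigma l / sigma (k-1)] when [sigma k > sigma (k-1)] is not
    immediate from the equation.  There lambda lies in [Gamma k], and
    Newton's inequalities [sigma (j-1) * sigma (j+1) <= sigma j ^ 2] make the
    ratios [sigma j / sigma (j+1)] nondecreasing for [j < k]; the last one is
    below 1, so all are, and [sigma l <= sigma (k-1)].

    Newton's inequality at [j] is needed only when [sigma 1, ..., sigma (j-1)]
    are positive, and in this form it has an induction on the number of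
    variables: remove a nonpositive variable if [sigma j <= 0] and a
    positive one if [sigma j > 0]. *)
Require Import Defs.
From mathcomp Require Import all_boot all_order all_algebra.
From mathcomp Require Import all_classical all_reals all_analysis.
From mathcomp Require Import lra.
Import Order.TTheory GRing.Theory Num.Theory.
Local Open Scope classical_set_scope.
Local Open Scope ring_scope.

(** The coefficient of ['X^j] is the [j]-th elementary symmetric function of [s]. *)
Definition esym_gen (R : comNzRingType) (s : seq R) : {poly R} :=
  \prod_(a <- s) (1 + a *: 'X).

Lemma esym_gen0 (R : comNzRingType) (s : seq R) : (esym_gen R s)`_0 = 1.
Proof.
rewrite /esym_gen; elim: s => [|a s IHs]; first by rewrite big_nil coef1.
by rewrite big_cons mulrDl mul1r -scalerAl coefD coefZ coefXM /= IHs mulr0 addr0.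
Qed.

Lemma coef_esym_gen_rem (R : comNzRingType) (s : seq R) (a : R) (j : nat) :
  a \in s -> (esym_gen R s)`_j = (esym_gen R (rem a s))`_j
    + a * (if j is i.+1 then (esym_gen R (rem a s))`_i else 0).
Proof.
move=> sa; rewrite /esym_gen (big_rem a) //= mulrDl mul1r -scalerAl.
by rewrite coefD coefZ coefXM; case: j.
Qed.

(** With nonnegative variables both terms of the recursion are nonnegative, so a coefficient that
    vanishes also vanishes for the tail, and the induction carries this one index up. The lemma is
    used to find a nonpositive variable. *)
Lemma esym_gen_ge0 (R : realDomainType) (s : seq R) (j : nat) :
  (forall a, a \in s -> 0 <= a) ->
  0 <= (esym_gen R s)`_j /\
  ((esym_gen R s)`_j = 0 -> (esym_gen R s)`_j.+1 = 0).
Proof.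
elim: s j => [|a s IHs] j s_ge0.
  by rewrite /esym_gen big_nil !coef1 ler0n.
have a_ge0 : 0 <= a by apply: s_ge0; rewrite mem_head.
have {}IHs i := IHs i (fun b sb => s_ge0 b (mem_behead (s := a :: s) sb)).
have sa : a \in a :: s by rewrite mem_head.
rewrite !(coef_esym_gen_rem R (a :: s) a _ sa) /= eqxx.
have [qj_ge0 qj0] := IHs j.
have aq_ge0 : 0 <= a * (if j is i.+1 then (esym_gen R s)`_i else 0).
  by case: (j) => [|i]; rewrite ?mulr0 // mulr_ge0 //; case: (IHs i).
split; first exact: addr_ge0.
move/eqP; rewrite paddr_eq0 // => /andP[/eqP qj_eq0 _].
by rewrite qj_eq0 qj0 // mulr0 addr0.
Qed.

(** Here and in the next two lemmas the [p]'s are consecutive coefficients after the variable [a] is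
    removed; sums such as [p1 + a * p0] are those before removal. *)
Lemma newton_step_neg (R : realFieldType) (a p0 p1 p2 p3 : R) :
  a <= 0 -> 0 <= p0 -> 0 < p1 -> p1 * p3 <= p2 ^+ 2 ->
  0 < p1 + a * p0 -> p2 + a * p1 <= 0 -> 0 < p3 + a * p2 ->
  (p1 + a * p0) * (p3 + a * p2) <= (p2 + a * p1) ^+ 2.
Proof.
move=> a_le0 p0_ge0 p1_gt0 newton e1_gt0 e2_le0 e3_gt0.
have [p2_gt0|p2_le0] := ltrP 0 p2.
  (* Here [- a < p3 / p2 <= p2 / p1], contradicting [e2_le0]. *)
  have h : 0 < p1 * (p3 + a * p2) by rewrite mulr_gt0.
  have h' : p2 * (p2 + a * p1) <= 0 by rewrite pmulr_rle0.
  nra.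
(* Dropping [a * p0] bounds the left side by [p1 * p3 + a * p1 * p2], hence by
   [p2 ^+ 2 + a * p1 * p2]. The right side exceeds this by [p2 * (a * p1) + (a * p1) ^+ 2]. *)
have ap0 : a * p0 <= 0 by rewrite mulr_le0_ge0.
have ap1 : a * p1 <= 0 by rewrite mulr_le0_ge0 // ltW.
have le1 : (p1 + a * p0) * (p3 + a * p2) <= p1 * (p3 + a * p2).
  by apply: ler_wpM2r; [exact: ltW | lra].
have h : 0 <= p2 * (a * p1) by rewrite mulr_le0.
have := sqr_ge0 (a * p1).
nra.
Qed.

(** Right side minus left side is a quadratic in [a] with coefficients [p2 ^+ 2 - p1 * p3],
    [p1 * p2 - p0 * p3] and [p1 ^+ 2 - p0 * p2]. The middle one is nonnegative by combining the two
    Newton inequalities. *)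
Lemma newton_step_pos (R : realFieldType) (a p0 p1 p2 p3 : R) :
  0 <= a -> 0 <= p0 -> 0 < p1 -> 0 < p2 ->
  p1 * p3 <= p2 ^+ 2 -> p0 * p2 <= p1 ^+ 2 ->
  (p1 + a * p0) * (p3 + a * p2) <= (p2 + a * p1) ^+ 2.
Proof.
move=> a_ge0 p0_ge0 p1_gt0 p2_gt0 newton newton'.
have p03 : p0 * p3 <= p1 * p2.
  rewrite -(ler_pM2l p1_gt0).
  have h : p0 * (p1 * p3) <= p0 * p2 ^+ 2 by rewrite ler_wpM2l.
  have h' : p2 * (p0 * p2) <= p2 * p1 ^+ 2 by rewrite ler_wpM2l // ltW.
  nra.
have h : a * (p0 * p3) <= a * (p1 * p2) by rewrite ler_wpM2l.
have h' : a ^+ 2 * (p0 * p2) <= a ^+ 2 * p1 ^+ 2 by rewrite ler_wpM2l // sqr_ge0.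
nra.
Qed.

(** If [p2 <= 0], then [p2 ^+ 2 + a * p1 * p2 <= 0 < p1 * p3 + a * p1 * p2], against Newton. So
    removing a variable of any sign costs at most the last positivity. *)
Lemma cone_step (R : realFieldType) (a p1 p2 p3 : R) :
  0 < p1 -> p1 * p3 <= p2 ^+ 2 ->
  0 < p2 + a * p1 -> 0 < p3 + a * p2 -> 0 < p2.
Proof.
move=> p1_gt0 newton e2_gt0 e3_gt0; rewrite ltNge; apply/negP => p2_le0.
have h : 0 < p1 * (p3 + a * p2) by rewrite mulr_gt0.
have h' : p2 * (p2 + a * p1) <= 0 by rewrite mulr_le0_ge0 // ltW.
nra.
Qed.

Lemma newton_esym_gen (R : realFieldType) (s : seq R) (m : nat) :
  (forall i, (i <= m)%N -> 0 < (esym_gen R s)`_i) ->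
  (esym_gen R s)`_m * (esym_gen R s)`_m.+2 <= (esym_gen R s)`_m.+1 ^+ 2.
Proof.
have [n] := ubnP (size s); elim: n s m => // n IHn s m /ltnSE sz e_gt0.
have [e3_le0|e3_gt0] := lerP (esym_gen R s)`_m.+2 0.
  by rewrite (le_trans _ (sqr_ge0 _)) // pmulr_rle0 // e_gt0.
have [e2_le0|e2_gt0] := lerP (esym_gen R s)`_m.+1 0.
(* Were all variables positive, the coefficient at [m.+1] would be zero, and so would the next one,
   which is positive. *)
- have [/hasP[a sa a_le0]|/hasPn s_gt0] := boolP (has (fun a => a <= 0) s); last first.
    have [a sa|e2_ge0 e3_0] := esym_gen_ge0 R s m.+1.
      by rewrite ltW // ltNge s_gt0.
    have e2_0 : (esym_gen R s)`_m.+1 = 0 by apply/eqP; rewrite eq_le e2_le0.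
    by rewrite e3_0 // ltxx in e3_gt0.
  (* Removing [a <= 0] can only increase these coefficients, as [- a] times a positive one is
     added. *)
  have q_gt0 i : (i <= m)%N -> 0 < (esym_gen R (rem a s))`_i.
    elim: i => [|i IHi] im; first by rewrite esym_gen0.
    have := e_gt0 _ im; rewrite (coef_esym_gen_rem R s a) //.
    have : a * (esym_gen R (rem a s))`_i <= 0.
      by rewrite mulr_le0_ge0 // ltW // IHi // ltnW.
    lra.
  have sz' : (size (rem a s) < n)%N by rewrite size_rem //; case: (s) sa sz.
  have newton := IHn _ m sz' q_gt0.
  move: e2_le0 e3_gt0 (e_gt0 m (leqnn m)).
  rewrite !(coef_esym_gen_rem R s a _ sa) => e2_le0 e3_gt0 e1_gt0.
  apply: newton_step_neg => //; last exact: q_gt0.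
  (* For [m = 0] the coefficient of index -1 is 0 by convention. *)
  by case: (m) q_gt0 => // i; move/(_ i (leqnSn i))/ltW.
- have e_gt0' i : (i <= m.+2)%N -> 0 < (esym_gen R s)`_i.
    by rewrite leq_eqVlt => /predU1P[->//|]; rewrite ltnS leq_eqVlt;
      move=> /predU1P[->//|/e_gt0].
  have [/hasP[a sa a_gt0]|/hasPn s_le0] := boolP (has (fun a => 0 < a) s); last first.
    have : (esym_gen R s)`_1 <= 0.
      have {}s_le0 a : a \in s -> a <= 0 by move=> /s_le0; rewrite -leNgt.
      elim: (s) s_le0 => [|a t IHt] t_le0.
        by rewrite /esym_gen big_nil coef1.
      rewrite (coef_esym_gen_rem R (a :: t) a) ?mem_head //= eqxx esym_gen0 mulr1.
      rewrite ler_wnDl ?IHt ?t_le0 ?mem_head // => b tb.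
      by rewrite t_le0 // inE tb orbT.
    by rewrite leNgt e_gt0'.
  have sz' : (size (rem a s) < n)%N by rewrite size_rem //; case: (s) sa sz.
  (* Positivity climbs one index at a time: Newton for the shorter sequence at [i] needs only the
     indices already reached. *)
  have q_gt0 i : (i <= m.+1)%N -> 0 < (esym_gen R (rem a s))`_i.
    elim/ltn_ind: i => -[|i] IHi im; first by rewrite esym_gen0.
    have newton := IHn _ i sz' (fun l (li : (l <= i)%N) => IHi l li (leq_trans li (ltnW im))).
    move: (e_gt0' i.+1 (ltnW im)) (e_gt0' i.+2 im).
    rewrite !(coef_esym_gen_rem R s a _ sa); apply: cone_step newton.
    by rewrite IHi // ltnW.
  rewrite !(coef_esym_gen_rem R s a _ sa); apply: newton_step_pos.
  + exact: ltW.
  + by case: (m) q_gt0 => // i; move/(_ i (leq_trans (leqnSn i) (leqnSn _)))/ltW.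
  + exact: q_gt0.
  + exact: q_gt0.
  + by apply: IHn => // i im; rewrite q_gt0 // leqW.
  + case: (m) IHn q_gt0 => [|i] IHn q_gt0; first by rewrite mul0r sqr_ge0.
    by apply: IHn => // l li; rewrite q_gt0 // !leqW.
Qed.

Lemma sigma_esym_gen (R : realType) (n j : nat) (x : 'rV[R]_n) :
  sigma j x = (esym_gen R [seq x 0 i | i <- enum 'I_n])`_j.
Proof.
rewrite /esym_gen big_map big_enum /=.
under eq_bigr do rewrite addrC.
rewrite bigA_distr coef_sum /sigma big_mkcond; apply: eq_bigr => A _.
rewrite -big_mkcond /= scaler_prod prodr_const coefZ coefXn eq_sym.
by case: eqP; rewrite ?mulr1 ?mulr0.
Qed.

Lemma sigma0 (R : realType) (n : nat) (x : 'rV[R]_n) : sigma 0 x = 1.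
Proof. by rewrite sigma_esym_gen esym_gen0. Qed.

Lemma Gamma_sigma_gt0 (R : realType) (n j i : nat) (x : 'rV[R]_n) :
  Gamma j x -> (i <= j)%N -> 0 < sigma i x.
Proof. by case: i => [|i] Gx ij; [rewrite sigma0|apply: Gx]. Qed.

(** Newton turns [sigma k.+1 <= sigma k.+2] into [sigma k <= sigma k.+1], so the comparison descends
    to every lower index. *)
Lemma sigma_le_of_le_last (R : realType) (n k l : nat) (x : 'rV[R]_n) :
  Gamma k x -> sigma k x <= sigma k.+1 x -> (l <= k)%N -> sigma l x <= sigma k x.
Proof.
elim: k => [|k IHk] Gx last_le; first by rewrite leqn0 => /eqP ->.
have sk_gt0 : 0 < sigma k x by apply: Gamma_sigma_gt0 Gx _.
have sk1_gt0 : 0 < sigma k.+1 x by apply: Gamma_sigma_gt0 Gx _.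
have newton : sigma k x * sigma k.+2 x <= sigma k.+1 x ^+ 2.
  rewrite !sigma_esym_gen; apply: newton_esym_gen => i ik.
  by rewrite -sigma_esym_gen; apply: Gamma_sigma_gt0 Gx (leqW ik).
have le_k : sigma k x <= sigma k.+1 x.
  rewrite -(ler_pM2r sk1_gt0) -expr2; apply: le_trans newton.
  by rewrite ler_pM2l.
rewrite leq_eqVlt => /predU1P[->//|lk]; apply: (le_trans _ le_k).
by apply: IHk le_k lk => i /andP[i_gt0 ik]; apply: Gx; rewrite i_gt0 leqW.
Qed.

Lemma ratio_le1 (R : realType) (n k l : nat) (x : 'rV[R]_n) :
  Gamma k x -> 1 < sigma k.+1 x / sigma k x -> (l <= k)%N ->
  sigma l x / sigma k x <= 1.
Proof.
move=> Gx; have sk_gt0 : 0 < sigma k x by apply: Gamma_sigma_gt0 Gx _.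
rewrite ltr_pdivlMr // mul1r => /ltW last_le lk.
by rewrite ler_pdivrMr // mul1r sigma_le_of_le_last.
Qed.

Theorem lemma2p8 (R : realType) (n k : nat) (hn : (2 <= n)%N)
    (hk : (2 <= k <= n)%N) :
  exists (C : R -> R -> R) (C' : ('I_k.-1 -> R) -> R -> R),
  forall (M : closed_kahler_manifold R n) (beta : nat -> M -> R)
    (lambda : M -> 'rV[R]_n),
  (forall i, (i < k)%N -> has_ubound (range (fun z => `|beta i z|))) ->
  (forall z, Gamma k.-1 (lambda z)) ->
  (forall z, sigma k (lambda z) / sigma k.-1 (lambda z)
     - \sum_(l < k.-1) beta l z * (sigma l (lambda z) / sigma k.-1 (lambda z))
     = beta k.-1 z) ->
  (forall l, (l <= k - 2)%N -> forall z, 0 <= beta l z) ->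
  (forall l, (l <= k - 2)%N ->
     (forall z, 0 < sigma l (lambda z) / sigma k.-1 (lambda z)) /\
     (0 < inf (range (beta l)) ->
      forall z, sigma l (lambda z) / sigma k.-1 (lambda z) <=
        C (inf (range (beta l))) (sup (range (fun y => `|beta k.-1 y|))))) /\
  (forall z,
     - sup (range (fun y => `|beta k.-1 y|))
       <= sigma k (lambda z) / sigma k.-1 (lambda z) /\
     sigma k (lambda z) / sigma k.-1 (lambda z)
       <= C' (fun l => inf (range (beta l)))
            (sup (range (fun y => \sum_(i < k) `|beta i y|)))).
Proof.
(* In each constant one summand serves the case [sigma k > sigma (k-1)] and the other the opposite
   case; a sum replaces the maximum. *)
exists (fun b B => 1 + (1 + B) / b), (fun _ S => 1 + S) => M beta lambda.
case: k hk => [|[|k]] //= _; rewrite subSS subn1 /= => bdd Gl eqn beta_ge0.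
have ratio_gt0 l z : (l <= k.+1)%N -> 0 < sigma l (lambda z) / sigma k.+1 (lambda z).
  by move=> lk; rewrite divr_gt0 //; apply: Gamma_sigma_gt0 (Gl z) _.
have term_ge0 (l : 'I_k.+1) z :
    0 <= beta l z * (sigma l (lambda z) / sigma k.+1 (lambda z)).
  have lk : (l <= k)%N by rewrite -ltnS.
  by rewrite mulr_ge0 ?beta_ge0 // ltW // ratio_gt0 // leqW.
have beta_le z : `|beta k.+1 z| <= sup (range (fun y => `|beta k.+1 y|)).
  by apply: ub_le_sup; [exact: bdd|exists z].
have sum_le z : \sum_(i < k.+2) `|beta i z|
    <= sup (range (fun y => \sum_(i < k.+2) `|beta i y|)).
  (* A supremum dominates only on a bounded set; the sum of the separate suprema is a bound. *)
  apply: ub_le_sup; last by exists z.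
  exists (\sum_(i < k.+2) sup (range (fun y => `|beta i y|))) => _ [y _ <-].
  by apply: ler_sum => i _; apply: ub_le_sup; [exact: bdd|exists y].
split=> [l lk|z].
  split=> [z|inf_gt0 z]; first by apply: ratio_gt0; rewrite leqW.
  have inf_le : inf (range (beta l)) <= beta l z.
    by apply: ge_inf; [exists 0 => _ [y _ <-]; exact: beta_ge0|exists z].
  have B_ge0 := le_trans (normr_ge0 _) (beta_le z).
  have [big|small] := ltrP 1 (sigma k.+2 (lambda z) / sigma k.+1 (lambda z)).
    rewrite (le_trans (ratio_le1 _ _ _ _ _ (Gl z) big (leqW lk))) // lerDl.
    by rewrite divr_ge0 ?ltW // ltr_pwDl.
  (* The equation bounds the whole sum by [1 + B], and its [l]-th term is at least the infimum times
     the ratio. *)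
  apply: ler_wpDl => //; rewrite ler_pdivlMr // mulrC.
  have term_le : beta l z * (sigma l (lambda z) / sigma k.+1 (lambda z)) <=
      \sum_(i < k.+1) beta i z * (sigma i (lambda z) / sigma k.+1 (lambda z)).
    rewrite (bigD1 (Ordinal (lk : (l < k.+1)%N))) //= lerDl.
    by apply: sumr_ge0 => i _; exact: term_ge0.
  have inf_term := ler_wpM2r (ltW (ratio_gt0 l z (leqW lk))) inf_le.
  have := eqn z; have := ler_norm (- beta k.+1 z); rewrite normrN.
  have := beta_le z; lra.
have sum_ge0 : 0 <=
    \sum_(l < k.+1) beta l z * (sigma l (lambda z) / sigma k.+1 (lambda z)).
  by apply: sumr_ge0 => i _; exact: term_ge0.
split.
  have := eqn z; have := ler_norm (- beta k.+1 z); rewrite normrN.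
  have := beta_le z; lra.
have [big|small] := ltrP 1 (sigma k.+2 (lambda z) / sigma k.+1 (lambda z)).
  (* All ratios are at most 1 here, so the equation bounds the quotient by the sum of all
     [|beta i z|]. *)
  have le_sum :
      \sum_(l < k.+1) beta l z * (sigma l (lambda z) / sigma k.+1 (lambda z))
      <= \sum_(l < k.+1) `|beta l z|.
    apply: ler_sum => l _; have lk : (l <= k)%N by rewrite -ltnS.
    rewrite ger0_norm ?ler_piMr ?beta_ge0 //.
    by apply: ratio_le1 (Gl z) big _; apply: leqW.
  have := sum_le z; rewrite big_ord_recr /=.
  have := eqn z; have := ler_norm (beta k.+1 z); lra.
have : 0 <= \sum_(i < k.+2) `|beta i z| by apply: sumr_ge0.
have := sum_le z; lra.
Qed.
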